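(* Let $C$ be a nonempty closed convex subset of a real Hilbert space $H$. Let $\alpha>0$, let $A:C\to H$ be an $\alpha$-inverse strongly monotone mapping and let $T:C\to C$ be a nonexpansive mapping such that $F=F(T)\cap\Omega\neq\emptyset$, where $F(T)=\{x\in C: Tx=x\}$ and $\Omega=\{x\in C:\langle Ax,y-x\rangle\ge 0\ \ \forall y\in C\}$. Let $\{\lambda_n\}_{n\ge 0}\subset[a,b]$ for some $a,b\in(0,2\alpha)$ and $\{\alpha_n\}_{n\ge 0}\subset[c,d]$ for some $c,d\in(0,1)$. For an arbitrary initial value $x_0\in C$, let $\{x_n\}$ be the sequence defined by $$\begin{cases} y_n=\alpha_n x_n+(1-\alpha_n)\,T P_C(x_n-\lambda_n A x_n),\\ x_{n+1}=T P_C(y_n-\lambda_n A y_n),\end{cases}\qquad \forall n\ge 0.$$ Then the sequence $\{x_n\}$ converges weakly to a point $p\in F$, where $p=\lim_{n\to\infty}P_F x_n$.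
   Context: $\langle\cdot,\cdot\rangle$ and $\|\cdot\|$ denote the inner product and norm of $H$. A mapping $T:C\to C$ is nonexpansive if $\|Tx-Ty\|\le\|x-y\|$ for all $x,y\in C$. For $\alpha>0$, a mapping $A:C\to H$ is $\alpha$-inverse strongly monotone if $\langle Ax-Ay,x-y\rangle\ge\alpha\|Ax-Ay\|^2$ for all $x,y\in C$. For a nonempty closed convex set $K\subset H$, $P_K:H\to K$ is the metric projection: $P_Kx$ is the unique point of $K$ with $\|x-P_Kx\|=\inf\{\|x-y\|:y\in K\}$. The limit $\lim_{n\to\infty}P_Fx_n$ is in the norm (strong) topology. *)

(* Defs.v *)
From HB Require Import structures.
From mathcomp Require Import all_boot all_order all_algebra.
From mathcomp Require Import sesquilinear.
From mathcomp Require Import all_classical all_reals all_analysis.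

Set Implicit Arguments.
Unset Strict Implicit.
Unset Printing Implicit Defensive.

Import Order.TTheory GRing.Theory Num.Theory.
Import numFieldNormedType.Exports.

Local Open Scope classical_set_scope.
Local Open Scope ring_scope.

(* A real Hilbert space is a complete normed module H over R together with a
   positive definite symmetric bilinear form dot : {dot H for idfun} that
   induces the norm of H (and hence its topology). *)
Definition induces_norm (R : realType) (H : normedModType R)
    (dot : {dot H for (idfun : R -> R)}) :=
  forall x : H, `|x| = Num.sqrt (dot x x).

(* Mappings defined on a subset C are total functions on H; the values that
   they take outside C are never constrained. *)
Definition nonexpansive (R : realType) (H : normedModType R)
    (C : set H) (T : H -> H) :=
  forall x y, C x -> C y -> `|T x - T y| <= `|x - y|.

Definition inverse_strongly_monotone (R : realType) (H : normedModType R)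
    (dot : {dot H for (idfun : R -> R)}) (C : set H) (alpha : R) (A : H -> H) :=
  forall x y, C x -> C y ->
    alpha * `|A x - A y| ^+ 2 <= dot (A x - A y) (x - y).

Definition fixed_points (H : Type) (C : set H) (T : H -> H) : set H :=
  [set x | C x /\ T x = x].

Definition VI_solutions (R : realType) (H : normedModType R)
    (dot : {dot H for (idfun : R -> R)}) (C : set H) (A : H -> H) : set H :=
  [set x | C x /\ forall y, C y -> 0 <= dot (A x) (y - x)].

Definition is_nearest_point (R : realType) (H : normedModType R)
    (K : set H) (x p : H) :=
  K p /\ `|x - p| = inf [set `|x - y| | y in K].

(* In a Hilbert space the nearest point exists and is unique as soon as K is
   nonempty, closed and convex; otherwise the value is arbitrary (0 when there
   is no nearest point). *)
Definition metric_proj (R : realType) (H : normedModType R)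
    (K : set H) (x : H) : H :=
  xget 0 (is_nearest_point K x).

Definition weakly_converges (R : realType) (H : normedModType R)
    (u : nat -> H) (p : H) :=
  forall f : {linear H -> R^o}, continuous f -> f (u n) @[n --> \oo] --> f p.

(* Main.v *)
(* Let p be in F and z_n = P_C (x_n - lambda_n A x_n).  The obtuse angle
   condition for P_C, the variational inequality at p and strong monotonicity
   bound |A x_n - A p|^2, |x_n - z_n - lambda_n (A x_n - A p)|^2 and
   |x_n - T z_n|^2, up to constants, by |x_n - p|^2 - |x_(n+1) - p|^2.  Hence
   x_n is Fejer monotone with respect to F, all three quantities vanish, and
   A x_n -> A p strongly.  Demiclosedness then puts every weak limit point of
   x_n in F: T by Browder's principle, A because it is constant on F and A x_n
   converges strongly to this constant.
   By Fejer monotonicity P_F x_n converges to some q, and the obtuse angle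
   condition for P_F forces every weak limit point of x_n to be q.  Weak
   compactness is used along ultrafilters rather than subsequences: a bounded
   sequence has a weak limit along each ultrafilter, by the Riesz
   representation of v |-> lim <v, x_n>. *)
Require Import Defs.
From HB Require Import structures.
From mathcomp Require Import all_boot all_order all_algebra.
From mathcomp Require Import sesquilinear.
From mathcomp Require Import all_classical all_reals all_analysis.
From mathcomp Require Import ring lra.

Set Implicit Arguments.
Unset Strict Implicit.
Unset Printing Implicit Defensive.

Import Order.TTheory GRing.Theory Num.Theory.
Import numFieldNormedType.Exports.

Local Open Scope classical_set_scope.
Local Open Scope ring_scope.

(** * Convexity with real coefficients, and norm convergence from squared bounds *)

Lemma convex_setP (R : realType) (E : lmodType R) (K : set E) :
  convex_set K <->
  forall x y t, K x -> K y -> 0 <= t -> t <= 1 -> K (t *: x + (1 - t) *: y).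
Proof.
split => [cK x y t Kx Ky t0 t1|cK x y t /[!inE] Kx Ky].
  have := cK x y (Itv01 t0 t1) (mem_set Kx) (mem_set Ky).
  by rewrite inE.
exact: cK.
Qed.

(** Turns each gain term of the Fejer estimate, dominated by a vanishing decrement, into strong
    convergence. *)
Lemma sqnorm_squeeze0 (R : realType) (V : normedModType R) (I : Type)
    (F : set_system I) {FF : ProperFilter F} (e : I -> R) (v : I -> V) (t : R) :
  0 < t -> (forall i, t * `|v i| ^+ 2 <= e i) -> e @ F --> 0 -> v @ F --> 0.
Proof.
move=> t0 ve e0; apply/cvgr0Pnorm_le => r r0.
have tr0 : 0 < t * r ^+ 2 by rewrite mulr_gt0 // exprn_gt0.
apply: filterS (cvgr_lt _ e0 _ tr0) => i ei.
rewrite -ler_sqr ?nnegrE ?(ltW r0) // -(ler_pM2l t0).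
exact/ltW/(le_lt_trans (ve i)).
Qed.

(** * Real limits along ultrafilters *)

Section UltraConvergence.
Variables (R : realType) (I : Type).

(** If the preimage of a neighbourhood were not in [F], the trace of [F] on its complement would be
    proper, and an ultrafilter above that trace would contain both sets. *)
Lemma cvg_ultraP (F : set_system I) (g : I -> R) (l : R) : ProperFilter F ->
  (forall U : set_system I, UltraFilter U -> F `<=` U -> g @ U --> l) ->
  g @ F --> l.
Proof.
move=> FF gU A lA; apply: contrapT => nFA.
have WF : ProperFilter (within (~` (g @^-1` A)) F).
  split; last exact: within_filter.
  move=> W0; apply: nFA; change (F (g @^-1` A)).
  apply: (filterS _ (W0 : F [set i | ~ (g @^-1` A) i -> set0 i])) => i gA.
  by apply: contrapT => /gA.
have [U [UU sU]] := ultraFilterLemma WF.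
have FU : F `<=` U by move=> B FB; apply: sU; apply: filterS FB => i Bi _.
have UA : U (g @^-1` A) by apply: (gU U UU FU).
have UnA : U (~` (g @^-1` A)) by apply: sU; exact: withinT.
by have [i []] := filter_ex (filterI UA UnA).
Qed.

(** Compactness of [-M, M] yields a cluster point, and an ultrafilter converges to its cluster
    points. *)
Lemma bounded_ultra_cvg (U : set_system I) (g : I -> R) (M : R) :
  UltraFilter U -> (forall i, `|g i| <= M) -> cvg (g @ U).
Proof.
move=> UU gM.
have UM : (g @ U) `[- M, M]%classic.
  change (U (g @^-1` `[- M, M])); apply: filterE => i /=.
  by rewrite in_itv /= -ler_norml gM.
have [l [_ lcl]] := @segment_compact R (- M) M (g @ U) _ UM.
apply/cvg_ex; exists l => A lA.
have [//|UnA] := in_ultra_setVsetC (g @^-1` A) UU.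
by have [y []] := lcl (~` A) A UnA lA.
Qed.

End UltraConvergence.

(** * Inner product identities and inequalities *)

Section Hilbert.
Variables (R : realType) (H : completeNormedModType R).
Variable dot : {dot H for (idfun : R -> R)}.
Hypothesis dot_norm : induces_norm dot.

Lemma dotC x y : dot x y = dot y x.
Proof. by rewrite hermC expr0 mul1r. Qed.

Lemma dotDr x y z : dot x (y + z) = dot x y + dot x z.
Proof. exact: linearDr. Qed.

Lemma dotNr x y : dot x (- y) = - dot x y.
Proof. exact: linearNr. Qed.

Lemma dotZr a x y : dot x (a *: y) = a * dot x y.
Proof. exact: linearZr_LR. Qed.

Lemma dotDl x y z : dot (y + z) x = dot y x + dot z x.
Proof. by rewrite !(dotC _ x) dotDr. Qed.

Lemma dotNl x y : dot (- y) x = - dot y x.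
Proof. by rewrite !(dotC _ x) dotNr. Qed.

Lemma dotZl a x y : dot (a *: y) x = a * dot y x.
Proof. by rewrite !(dotC _ x) dotZr. Qed.

Lemma dot0r x : dot x 0 = 0.
Proof. by rewrite -[X in dot x X](scale0r 0) dotZr mul0r. Qed.

Lemma dot0l x : dot 0 x = 0.
Proof. by rewrite dotC dot0r. Qed.

Definition dotE := (dotDr, dotNr, dotZr, dotDl, dotNl, dotZl).

Lemma dot_sqnorm x : dot x x = `|x| ^+ 2.
Proof.
rewrite dot_norm sqr_sqrtr //.
have [->|x0] := eqVneq x 0; first by rewrite dot0r.
exact/ltW/neq0_dnorm_gt0.
Qed.

Lemma dot_ge0 x : 0 <= dot x x.
Proof. by rewrite dot_sqnorm sqr_ge0. Qed.

Lemma dot_le0_eq x y : dot (x - y) (x - y) <= 0 -> x = y.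
Proof.
rewrite dot_sqnorm => h; apply/eqP; rewrite -subr_eq0 -normr_eq0 -sqrf_eq0.
by rewrite eq_le h sqr_ge0.
Qed.

Lemma ler_norm_dot x y : (`|x| <= `|y|) = (dot x x <= dot y y).
Proof. by rewrite !dot_sqnorm ler_sqr ?nnegrE. Qed.

Lemma sqnormB x y : dot (x - y) (x - y) = dot x x - 2 * dot x y + dot y y.
Proof. by rewrite !dotE (dotC y x); ring. Qed.

Lemma sqnorm_conv (t : R) (x y : H) : `|t *: x + (1 - t) *: y| ^+ 2 =
  t * `|x| ^+ 2 + (1 - t) * `|y| ^+ 2 - t * (1 - t) * `|x - y| ^+ 2.
Proof. by rewrite -!dot_sqnorm !dotE (dotC y x); ring. Qed.

Lemma CauchySchwarz x y : `|dot x y| <= `|x| * `|y|.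
Proof.
have [->|y0] := eqVneq y 0; first by rewrite dot0r !normr0 mulr0.
have yy0 : 0 < dot y y by rewrite dot_sqnorm exprn_gt0 ?normr_gt0.
rewrite -ler_sqr ?nnegrE ?mulr_ge0 // exprMn -!dot_sqnorm.
rewrite real_normK ?num_real //.
(* This square expands to |y|^2 (|x|^2 |y|^2 - <x, y>^2). *)
have := dot_ge0 (dot y y *: x - dot x y *: y).
rewrite sqnormB !dotE => h.
have {h} : 0 <= dot y y * (dot x x * dot y y - dot x y ^+ 2) by nra.
by rewrite pmulr_rge0 // subr_ge0.
Qed.

Lemma sqnorm_cauchy_cvg (u : nat -> H) :
  (forall e, 0 < e -> exists N, forall n m, (N <= n)%N -> (N <= m)%N ->
     `|u n - u m| ^+ 2 <= e) -> cvgn u.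
Proof.
move=> uC; apply: cauchy_cvg; apply: cauchy_exP => e e0.
have e2 : 0 < e / 2 by rewrite divr_gt0.
have [N hN] := uC ((e / 2) ^+ 2) (exprn_gt0 _ e2).
exists (u N); exists N => // n /= Nn; rewrite -ball_normE /=.
have := hN _ _ (leqnn N) Nn.
rewrite ler_sqr ?nnegrE ?(ltW e2) // => /le_lt_trans; apply.
by rewrite ltr_pdivrMr // mulr2n mulrDr mulr1 ltrDl.
Qed.

(** * The metric projection onto a closed convex set *)

Lemma nearest_point_minE (K : set H) (x p : H) :
  is_nearest_point K x p <-> K p /\ forall y, K y -> `|x - p| <= `|x - y|.
Proof.
have lbK : has_lbound [set `|x - y| | y in K].
  by exists 0 => _ [y _ <-]; exact: normr_ge0.
split=> [[Kp pE]|[Kp pmin]]; split => //.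
  by move=> y Ky; rewrite pE; apply: ge_inf => //; exists y.
apply/eqP; rewrite eq_le; apply/andP; split.
  apply: lb_le_inf; first by exists `|x - p|, p.
  by move=> _ [y Ky <-]; exact: pmin.
by apply: ge_inf => //; exists p.
Qed.

(* The parallelogram identity turns a minimizing sequence into a Cauchy one. *)
Lemma nearest_point_ex (K : set H) (x : H) : K !=set0 -> closed K ->
  convex_set K -> exists p, is_nearest_point K x p.
Proof.
move=> [k0 Kk0] Kcl /convex_setP Kcv.
pose S := [set dot (x - y) (x - y) | y in K].
have lbS : has_lbound S by exists 0 => _ [y _ <-]; exact: dot_ge0.
have infS : has_inf S by split => //; exists (dot (x - k0) (x - k0)), k0.
have /choice [k hk] (n : nat) : exists y, K y /\
    dot (x - y) (x - y) < inf S + n.+1%:R^-1.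
  have n0 : 0 < n.+1%:R^-1 :> R by rewrite invr_gt0.
  by have [_ [y Ky <-] yS] := inf_adherent n0 infS; exists y.
have kC n m : `|k n - k m| ^+ 2 <= 2 * (n.+1%:R^-1 + m.+1%:R^-1).
  rewrite -dot_sqnorm; have [[Kn kn] [Km km]] := (hk n, hk m).
  have Kmid : K (2^-1 *: k n + (1 - 2^-1) *: k m).
    by apply: Kcv; rewrite ?invr_ge0 ?invf_le1 ?ler1n.
  (* The squared distance to the midpoint is at least [inf S], so the parallelogram identity leaves
     only the two excesses over [inf S], each doubled. *)
  have : inf S <= dot (x - (2^-1 *: k n + (1 - 2^-1) *: k m))
                      (x - (2^-1 *: k n + (1 - 2^-1) *: k m)).
    by apply: ge_inf => //; eexists; first exact: Kmid.
  move: kn km; rewrite !dotE !(dotC _ x) (dotC (k m) (k n)).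
  by move: (n.+1%:R^-1) (m.+1%:R^-1) => r1 r2; lra.
have small (e : R) : 0 < e -> \forall n \near \oo, n.+1%:R^-1 < e.
  by move=> e0; exact: (near_infty_natSinv_lt (PosNum e0)).
have /cvg_ex [p kp] : cvgn k.
  apply: sqnorm_cauchy_cvg => e e0.
  have [|N _ hN] := small (e / 4); first by rewrite divr_gt0.
  exists N => n m Nn Nm; move: (kC n m) (hN n Nn) (hN m Nm) => /=.
  by move: (n.+1%:R^-1) (m.+1%:R^-1) => r1 r2; lra.
exists p; apply/nearest_point_minE; split.
  by apply: (closed_cvg _ Kcl _ _ kp); apply: nearW => n; have [] := hk n.
move=> y Ky; rewrite ler_norm_dot //.
have yS : inf S <= dot (x - y) (x - y) by apply: ge_inf => //; exists y.
apply/ler_addgt0Pr => e e0; rewrite [X in X <= _]dot_sqnorm.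
have xkp : `|x - k n| ^+ 2 @[n --> \oo] --> `|x - p| ^+ 2.
  by rewrite expr2; under eq_fun do rewrite expr2;
    apply: cvgM; apply: cvg_norm; apply: cvgB => //; exact: cvg_cst.
apply: (cvgr_to_le xkp); near=> n.
have [_ xkn] := hk n; rewrite -dot_sqnorm.
have : n.+1%:R^-1 < e by near: n; exact: small.
by move: xkn; move: (n.+1%:R^-1) => r; lra.
Unshelve. all: by end_near. Qed.

Lemma metric_proj_nearest (K : set H) (x : H) : K !=set0 -> closed K ->
  convex_set K -> is_nearest_point K x (metric_proj K x).
Proof.
by move=> K0 Kcl Kcv; apply: (xgetPex 0); exact: nearest_point_ex.
Qed.

Lemma metric_proj_in (K : set H) (x : H) : K !=set0 -> closed K ->
  convex_set K -> K (metric_proj K x).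
Proof. by move=> K0 Kcl Kcv; case: (metric_proj_nearest x K0 Kcl Kcv). Qed.

(** If the angle at the projection p were acute, a short move from p towards y inside K would come
    closer to x. *)
Lemma metric_proj_obtuse (K : set H) (x y : H) : closed K -> convex_set K ->
  K y -> dot (x - metric_proj K x) (y - metric_proj K x) <= 0.
Proof.
move=> Kcl Kcv Ky; have K0 : K !=set0 by exists y.
have := metric_proj_nearest x K0 Kcl Kcv.
move/nearest_point_minE; set p := metric_proj K x => -[Kp pmin].
move/convex_setP : Kcv => Kcv.
rewrite leNgt; apply/negP; set s := dot _ _ => s0.
pose N := dot (y - p) (y - p); have N0 : 0 <= N by exact: dot_ge0.
have sN : 0 < s + N by lra.
(* Moving by t changes the squared distance by t (t N - 2 s), which is negative for this t; having s
   in the denominator keeps t in (0, 1] even if N = 0. *)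
pose t := s / (s + N).
have t0 : 0 < t by rewrite divr_gt0.
have t1 : t <= 1 by rewrite ler_pdivrMr // mul1r; lra.
have := pmin _ (Kcv _ _ _ Ky Kp (ltW t0) t1); rewrite ler_norm_dot //.
have -> : x - (t *: y + (1 - t) *: p) = (x - p) - t *: (y - p).
  by rewrite scalerBl scale1r scalerBr addrCA opprD addrA.
rewrite [dot (x - p - _) _]sqnormB !dotZr !dotZl -/s -/N => h.
have {h} : 0 <= t * (t * N - 2 * s) by lra.
rewrite pmulr_rge0 //; have tE : t * (s + N) = s by rewrite divfK ?gt_eqF.
by nra.
Qed.

(** * Riesz representation and weak limits along ultrafilters *)

(** The point k of the hyperplane f = 1 nearest to 0 is orthogonal to the kernel of f, so k / |k|^2
    represents f. *)
Lemma continuous_linear_dot (f : {linear H -> R^o}) : continuous f ->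
  exists v, forall y, f y = dot v y.
Proof.
move=> fct; have [f0|] := pselect (forall y, f y = 0).
  by exists 0 => y; rewrite f0 dot0l.
move=> /existsNP [e /eqP fe0].
pose K : set H := f @^-1` [set (1 : R^o)].
have K0 : K !=set0.
  by exists ((f e)^-1 *: e); rewrite /K /= linearZ /= /GRing.scale /= mulVf.
have Kcl : closed K.
  by apply: preimage_closed => [y _|]; [exact: fct|exact: closed_eq].
have Kcv : convex_set K.
  apply/convex_setP => x y t /= fx fy _ _.
  by rewrite /K /= linearD !linearZ /= fx fy /GRing.scale /= !mulr1 addrC subrK.
have Kk := metric_proj_in 0 K0 Kcl Kcv; set k := metric_proj K 0 in Kk.
have fk : f k = 1 := Kk.
have kk_neq0 : dot k k != 0.
  apply/eqP => kk0; have k0 : k = 0 by apply: dot_le0_eq; rewrite subr0 kk0.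
  by move/eqP: fk; rewrite k0 linear0 eq_sym oner_eq0.
have kerk h : f h = 0 -> 0 <= dot k h.
  move=> fh; have Kkh : K (k + h) by rewrite /K /= linearD fk fh addr0.
  have := metric_proj_obtuse 0 Kcl Kcv Kkh.
  by rewrite -/k addrAC subrr !add0r dotNl; lra.
exists ((dot k k)^-1 *: k) => y; rewrite dotZl.
have ker_y : f (y - f y *: k) = 0.
  by rewrite linearB linearZ /= fk /GRing.scale /= mulr1 subrr.
(* Testing a kernel vector and its opposite turns the inequality into orthogonality. *)
have := kerk _ ker_y; have := kerk (- (y - f y *: k)).
rewrite linearN ker_y oppr0 !dotE => /(_ erefl) h1 h2.
have -> : dot k y = f y * dot k k by lra.
by rewrite mulrCA mulVf ?mulr1.
Qed.

(** Testing against vectors along an arbitrary family of sets covers sequences, ultrafilters and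
    traces of neighbourhoods alike; Riesz representation links it to [weakly_converges]. *)
Definition weak_limit (I : Type) (F : set_system I) (x : I -> H) (p : H) :=
  forall v, dot v (x i) @[i --> F] --> dot v p.

(** By Cauchy-Schwarz each <v, x_i> is bounded, hence converges along [U]; the limit is linear in v
    and bounded by M |v|. *)
Lemma bounded_ultra_weak_limit (I : Type) (U : set_system I) (x : I -> H)
    (M : R) : UltraFilter U -> (forall i, `|x i| <= M) ->
  exists p, weak_limit U x p.
Proof.
move=> UU xM.
pose g (v : H) : R^o := lim (dot v (x i) @[i --> U]).
have bnd v i : `|dot v (x i)| <= M * `|v|.
  by rewrite (le_trans (CauchySchwarz _ _)) // mulrC ler_wpM2r.
have gE v : dot v (x i) @[i --> U] --> g v.
  exact: (bounded_ultra_cvg UU (bnd v)).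
have glin : linear g.
  move=> a u v; apply/cvg_lim => //.
  under eq_fun do rewrite dotDl dotZl.
  by apply: cvgD; [apply: cvgMl_tmp|].
pose gl : {linear H -> R^o} :=
  HB.pack g (GRing.isLinear.Build R H R^o _ g glin).
have gct : continuous gl.
  apply: bounded_linear_continuous; apply/linear_boundedP.
  near=> r => v.
  have vM : `|g v| <= M * `|v|.
    apply: (cvgr_to_le (cvg_norm (gE v))); exact: nearW.
  by rewrite (le_trans vM) // ler_wpM2r //; near: r; exact: nbhs_pinfty_ge.
have [p gp] := continuous_linear_dot gct.
by exists p => v; rewrite dotC -gp; exact: gE.
Unshelve. all: by end_near. Qed.

(** * Weak limits: closed convex sets and demiclosedness *)

Section WeakLimits.
Variables (I : Type) (F : set_system I).
Context {FF : ProperFilter F}.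

(** In <x_i, y_i> = <q, x_i> + <x_i, y_i - q>, the last term is at most M |y_i - q| in absolute
    value. *)
Lemma cvg_dot_weak_strong (x y : I -> H) (M : R) (p q : H) :
  weak_limit F x p -> (\forall i \near F, `|x i| <= M) -> y @ F --> q ->
  dot (x i) (y i) @[i --> F] --> dot p q.
Proof.
move=> xp xM yq.
have -> : (fun i => dot (x i) (y i)) =
    (fun i => dot q (x i) + dot (x i) (y i - q)).
  by apply/funext => i; rewrite (dotC q) -dotDr addrC subrK.
rewrite -[dot p q]addr0 (dotC p); apply: cvgD; first exact: xp.
apply: norm_cvg0.
have M0 : 0 <= M by have [i] := filter_ex xM; apply: le_trans.
apply: (@squeeze_cvgr _ _ _ _ (fun=> 0) (fun i => M * `|y i - q|)).
- near=> i; rewrite normr_ge0 /= (le_trans (CauchySchwarz _ _)) // ler_wpM2r //.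
  by near: i.
- exact: cvg_cst.
- rewrite -(mulr0 M); apply: cvgMl_tmp; rewrite -(@normr0 _ H) -(subrr q).
  by apply: cvg_norm; apply: cvgB => //; exact: cvg_cst.
Unshelve. all: by end_near. Qed.

Lemma cvg_weak_limit (x : I -> H) (p : H) : x @ F --> p -> weak_limit F x p.
Proof.
move=> xp v; apply: (@cvg_dot_weak_strong (fun=> v) x `|v|) => //.
  by move=> w; exact: cvg_cst.
exact: nearW.
Qed.

Lemma cvg_dot (x y : I -> H) (p q : H) : x @ F --> p -> y @ F --> q ->
  dot (x i) (y i) @[i --> F] --> dot p q.
Proof.
move=> xp; apply: (cvg_dot_weak_strong (M := `|p| + 1) (cvg_weak_limit xp)).
by apply: cvgr_norm_le xp _ _; rewrite ltrDl.
Qed.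

(** With v = p - P_K p, the obtuse angle condition <v, x_i - P_K p> <= 0 passes to the weak limit
    and becomes |v|^2 <= 0. *)
Lemma weak_limit_closed_convex (K : set H) (x : I -> H) (p : H) :
  closed K -> convex_set K -> (\forall i \near F, K (x i)) ->
  weak_limit F x p -> K p.
Proof.
move=> Kcl Kcv Kx xp.
have K0 : K !=set0 by have [i ?] := filter_ex Kx; exists (x i).
suff -> : p = metric_proj K p by exact: metric_proj_in.
apply: dot_le0_eq; set v := p - _.
have -> : dot v v = dot v p - dot v (metric_proj K p) by rewrite -dotNr -dotDr.
apply: (@cvgr_to_le _ F _ _ (fun i => dot v (x i - metric_proj K p))).
  under eq_fun do rewrite dotDr dotNr.
  by apply: cvgB; [exact: xp|exact: cvg_cst].
by apply: filterS Kx => i; exact: metric_proj_obtuse.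
Qed.

(* Browder's demiclosedness principle. *)
Lemma weak_limit_fixed (C : set H) (T : H -> H) (x : I -> H) (p : H) (M : R) :
  nonexpansive C T -> (\forall i \near F, C (x i)) -> C p ->
  weak_limit F x p -> (\forall i \near F, `|x i| <= M) ->
  x i - T (x i) @[i --> F] --> 0 -> T p = p.
Proof.
move=> Tne Cx Cp xp xM xT; apply/esym/dot_le0_eq.
(* The approximants are |x_i - T p|^2 - |x_i - p|^2 - 2 <x_i - T p, x_i - T x_i>, where |x_i|^2
   cancels in the first two terms. Nonexpansiveness bounds them by -|x_i - T x_i|^2. *)
have -> : dot (p - T p) (p - T p) =
    2 * dot (p - T p) p + (dot (T p) (T p) - dot p p)
    - 2 * (dot p 0 - dot (T p) 0).
  by rewrite !dot0r !dotE (dotC (T p) p); ring.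
apply: (@cvgr_to_le _ F _ _ (fun i => 2 * dot (p - T p) (x i)
    + (dot (T p) (T p) - dot p p)
    - 2 * (dot (x i) (x i - T (x i)) - dot (T p) (x i - T (x i))))).
  apply: cvgB; [apply: cvgD|apply: cvgMl_tmp; apply: cvgB].
  - by apply: cvgMl_tmp; exact: xp.
  - exact: cvg_cst.
  - exact: (cvg_dot_weak_strong xp xM xT).
  - exact: cvg_weak_limit.
apply: filterS Cx => i Cxi; have := Tne _ _ Cxi Cp.
have := dot_ge0 (x i - T (x i)).
by rewrite ler_norm_dot // !dotE !(dotC _ (x i)) !(dotC _ p) (dotC (T p)); lra.
Qed.

(** In the monotonicity inequality between x_i and p, the right-hand side <A x_i - A p, x_i - p>
    pairs a strong limit with a weak null limit, leaving alpha |w - A p|^2 <= 0. *)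
Lemma weak_limit_inverse_strongly_monotone (C : set H) (A : H -> H)
    (alpha : R) (x : I -> H) (p w : H) (M : R) :
  0 < alpha -> inverse_strongly_monotone dot C alpha A ->
  (\forall i \near F, C (x i)) -> C p ->
  weak_limit F x p -> (\forall i \near F, `|x i| <= M) ->
  A (x i) @[i --> F] --> w -> A p = w.
Proof.
move=> a0 Aism Cx Cp xp xM Aw.
have AxAp : A (x i) - A p @[i --> F] --> w - A p.
  by apply: cvgB => //; exact: cvg_cst.
apply/esym/dot_le0_eq; rewrite -(pmulr_rle0 _ a0).
have <- : dot p (w - A p) - dot p (w - A p) = 0 by rewrite subrr.
rewrite -subr_le0 dot_sqnorm.
apply: (@cvgr_to_le _ F _ _ (fun i => alpha * `|A (x i) - A p| ^+ 2
   - (dot (x i) (A (x i) - A p) - dot p (A (x i) - A p)))).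
  apply: cvgB; [apply: cvgMl_tmp|apply: cvgB].
  - by rewrite expr2; under eq_fun do rewrite expr2;
      apply: cvgM; exact: cvg_norm.
  - exact: (cvg_dot_weak_strong xp xM AxAp).
  - exact: cvg_weak_limit.
apply: filterS Cx => i Cxi; have := Aism _ _ Cxi Cp.
by rewrite -dotNl -dotDl dotC; lra.
Qed.

End WeakLimits.

(** * Fejer monotone sequences *)

Section Fejer.
Variables (K : set H) (x : nat -> H).
Hypotheses (K0 : K !=set0) (Kcl : closed K) (Kcv : convex_set K).
Hypothesis fejer : forall p n, K p -> `|x n.+1 - p| <= `|x n - p|.

Lemma fejer_le p n m : K p -> (n <= m)%N -> `|x m - p| <= `|x n - p|.
Proof.
move=> Kp /subnK <-; elim: (m - n)%N => // k IH.
by rewrite addSn; exact: le_trans (fejer _ Kp) IH.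
Qed.

Lemma fejer_bounded p n : K p -> `|x n| <= `|x 0%N - p| + `|p|.
Proof.
move=> Kp; rewrite -[x n](subrK p) (le_trans (ler_normD _ _)) // lerD2r.
exact: fejer_le.
Qed.

Let u n := metric_proj K (x n).

(** The obtuse angle at u_m gives |x_m - u_m|^2 + |u_m - u_n|^2 <= |x_m - u_n|^2, and Fejer
    monotonicity bounds the latter by |x_n - u_n|^2. *)
Lemma fejer_proj_sqdist n m : (n <= m)%N ->
  `|u m - u n| ^+ 2 <= `|x n - u n| ^+ 2 - `|x m - u m| ^+ 2.
Proof.
move=> nm; have Ku k : K (u k) by exact: metric_proj_in.
have := fejer_le (Ku n) nm; rewrite ler_norm_dot //.
have := metric_proj_obtuse (x m) Kcl Kcv (Ku n).
rewrite -/(u m) -!dot_sqnorm //.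
by rewrite !dotE !(dotC _ (x m)) !(dotC _ (x n)) (dotC (u m) (u n)); lra.
Qed.

(** The squared distances to K decrease to a limit, and their differences dominate |u_m - u_n|^2. *)
Lemma fejer_proj_cvg : cvgn u.
Proof.
pose d n := `|x n - u n| ^+ 2.
have d_decr : {homo d : n m / (n <= m)%N >-> m <= n}.
  move=> n m nm; rewrite -subr_ge0.
  exact: le_trans (sqr_ge0 _) (fejer_proj_sqdist nm).
have d_cvg : cvgn d.
  apply: nonincreasing_is_cvgn => //.
  by exists 0 => _ [n _ <-]; exact: sqr_ge0.
have d_ge n : limn d <= d n by exact: nonincreasing_cvgn_ge.
apply: sqnorm_cauchy_cvg => e e0.
have [N _ hN] := cvgr_lt _ d_cvg (limn d + e) (ltr_pwDr e0 (lexx _)).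
exists N => n m.
wlog nm : n m / (n <= m)%N => [hw Nn Nm|Nn _].
  by case: (leqP n m) => [|/ltnW] nm; [|rewrite distrC]; apply: hw.
rewrite distrC (le_trans (fejer_proj_sqdist nm)) //.
by have := hN n Nn; have := d_ge m; rewrite /d /=; lra.
Qed.

(* A weak ultralimit p in K is q = lim P_K x_n: the obtuse angle condition
   <x_n - P_K x_n, p - P_K x_n> <= 0 passes to the limit <p - q, p - q> <= 0. *)
Lemma fejer_weak_cvg :
  (forall (U : set_system nat) p, UltraFilter U -> \oo `<=` U ->
     weak_limit U x p -> K p) ->
  exists q, [/\ K q, weakly_converges x q & u n @[n --> \oo] --> q].
Proof.
move=> wK; have /cvg_ex [q uq] := fejer_proj_cvg.
have Ku k : K (u k) by exact: metric_proj_in.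
have Kq : K q by apply: (closed_cvg _ Kcl _ _ uq); exact: nearW.
exists q; split => // f fct.
have [v fE] := continuous_linear_dot fct.
under eq_fun do rewrite fE; rewrite fE.
have xM n := fejer_bounded n Kq.
apply: cvg_ultraP => U UU oU.
have [p xp] := bounded_ultra_weak_limit UU xM.
suff <- : p = q by exact: xp.
have Kp := wK _ _ UU oU xp.
have uqU : u n @[n --> U] --> q by move=> B Bq; apply: oU; exact: uq.
apply: dot_le0_eq.
have -> : dot (p - q) (p - q) = dot p (p - q) - dot q (p - q).
  by rewrite -dotNl -dotDl.
have puq : p - u n @[n --> U] --> p - q by apply: cvgB => //; exact: cvg_cst.
apply: (@cvgr_to_le _ U _ _
    (fun n => dot (x n) (p - u n) - dot (u n) (p - u n))).
  apply: cvgB; first by apply: (cvg_dot_weak_strong xp _ puq); exact: nearW.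
  exact: cvg_dot.
by apply: nearW => n; rewrite -dotNl -dotDl; exact: metric_proj_obtuse.
Qed.

End Fejer.

(** * Solutions of the variational inequality, and fixed points *)

Section VariationalInequality.
Variables (C : set H) (alpha : R) (A : H -> H).
Hypotheses (C_closed : closed C) (C_convex : convex_set C).
Hypotheses (alpha_gt0 : 0 < alpha).
Hypothesis A_ism : inverse_strongly_monotone dot C alpha A.

(** Testing each solution against the other gives <A p - A q, p - q> <= 0. *)
Lemma VI_solutions_eq p q :
  VI_solutions dot C A p -> VI_solutions dot C A q -> A p = A q.
Proof.
move=> [Cp Ap] [Cq Aq]; apply: dot_le0_eq; rewrite -(pmulr_rle0 _ alpha_gt0).
rewrite [X in _ * X]dot_sqnorm; apply: le_trans (A_ism Cp Cq) _.
have := Ap _ Cq; have := Aq _ Cp; rewrite !dotE; lra.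
Qed.

(** [A] is constant on the segment: weighting the monotonicity inequalities of z against p and q by
    t and 1 - t gives the right-hand side <A z - A p, z - z> = 0. *)
Lemma VI_solutions_convex : convex_set (VI_solutions dot C A).
Proof.
apply/convex_setP => p q t Sp Sq t0 t1.
have Apq := VI_solutions_eq Sp Sq.
case: Sp => [Cp Ap]; case: Sq => [Cq Aq].
set z := t *: p + (1 - t) *: q.
have Cz : C z by move/convex_setP: C_convex; apply.
have Az : A z = A p.
  apply: dot_le0_eq; rewrite -(pmulr_rle0 _ alpha_gt0) [X in _ * X]dot_sqnorm.
  have h1 := A_ism Cz Cp; have h2 := A_ism Cz Cq; rewrite -Apq in h2.
  have : t * dot (A z - A p) (z - p) + (1 - t) * dot (A z - A p) (z - q) = 0.
    have -> : 0 = dot (A z - A p) (z - (t *: p + (1 - t) *: q)) :> R.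
      by rewrite subrr dot0r.
    by rewrite !dotDr !dotNr dotDr !dotZr; ring.
  by nra.
split => // y Cy; rewrite Az.
have -> : dot (A p) (y - z) =
    t * dot (A p) (y - p) + (1 - t) * dot (A q) (y - q).
  by rewrite -Apq /z !dotDr !dotNr dotDr !dotZr; ring.
by rewrite addr_ge0 // mulr_ge0 ?Ap ?Aq ?subr_ge0.
Qed.

(** Twice the sum of three inequalities: the obtuse angle at z tested on p, and l times both the
    variational inequality at p tested on z and the monotonicity of [A] between x and p. *)
Lemma forward_backward_sqdist (x p : H) (l : R) :
  let z := metric_proj C (x - l *: A x) in
  C x -> VI_solutions dot C A p -> 0 <= l ->
  `|z - p| ^+ 2 + `|x - z - l *: (A x - A p)| ^+ 2
    + l * (2 * alpha - l) * `|A x - A p| ^+ 2 <= `|x - p| ^+ 2.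
Proof.
move=> z Cx [Cp Ap] l0.
have Cz : C z by apply: metric_proj_in => //; exists x.
have h1 := metric_proj_obtuse (x - l *: A x) C_closed C_convex Cp.
rewrite -/z in h1.
have h2 := mulr_ge0 l0 (Ap _ Cz).
have h3 := ler_wpM2l l0 (A_ism Cx Cp).
move: h1 h2 h3; rewrite -!dot_sqnorm //.
rewrite !dotE !(dotC _ x) !(dotC _ p) !(dotC _ z) !(dotC (A p)).
by rewrite !(dotC _ (A x)) !(dotC x) !(dotC p) !(dotC z); lra.
Qed.

End VariationalInequality.

(** By [zE], |w - z|^2 is nondecreasing in the distances from w to p and q. Those of T z are at most
    those of z, so |T z - z|^2 <= |z - z|^2 = 0. *)
Lemma fixed_points_convex (C : set H) (T : H -> H) : convex_set C ->
  nonexpansive C T -> convex_set (fixed_points C T).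
Proof.
move=> /convex_setP Ccv Tne; apply/convex_setP => p q t [Cp Tp] [Cq Tq] t0 t1.
set z := t *: p + (1 - t) *: q.
have Cz : C z by exact: Ccv.
split => //; apply: dot_le0_eq.
have zE w : `|w - z| ^+ 2 = t * `|w - p| ^+ 2
    + (1 - t) * `|w - q| ^+ 2 - t * (1 - t) * `|p - q| ^+ 2.
  have -> : p - q = - ((w - p) - (w - q)).
    by rewrite !opprB [RHS]addrC addrA subrK.
  rewrite normrN -sqnorm_conv /z !scalerBr addrACA -opprD -scalerDl.
  by rewrite (addrC t) subrK scale1r.
have hp : `|T z - p| ^+ 2 <= `|z - p| ^+ 2.
  by rewrite -{1}Tp ler_sqr ?nnegrE //; exact: Tne.
have hq : `|T z - q| ^+ 2 <= `|z - q| ^+ 2.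
  by rewrite -{1}Tq ler_sqr ?nnegrE //; exact: Tne.
rewrite dot_sqnorm zE; have := zE z; rewrite subrr normr0 expr0n /=.
have t1' : 0 <= 1 - t by lra.
by have := ler_wpM2l t0 hp; have := ler_wpM2l t1' hq; lra.
Qed.

(** * The set of common solutions *)

Section CommonSolutions.
Variables (C : set H) (alpha : R) (A T : H -> H).
Hypotheses (C_closed : closed C) (C_convex : convex_set C).
Hypotheses (alpha_gt0 : 0 < alpha).
Hypothesis A_ism : inverse_strongly_monotone dot C alpha A.
Hypothesis T_nonexp : nonexpansive C T.

Let S := fixed_points C T `&` VI_solutions dot C A.

(** Serves both for the closedness of [S] and for the weak limits of the iteration. *)
Lemma weak_limit_common_solution (I : Type) (F : set_system I)
    (x : I -> H) (p w : H) (M : R) : ProperFilter F ->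
  (\forall i \near F, C (x i)) -> weak_limit F x p ->
  (\forall i \near F, `|x i| <= M) ->
  x i - T (x i) @[i --> F] --> 0 -> A (x i) @[i --> F] --> w ->
  (forall y, C y -> 0 <= dot w (y - p)) -> S p.
Proof.
move=> FF Cx xp xM xT Aw wp.
have Cp : C p by exact: weak_limit_closed_convex Cx xp.
have Tp : T p = p := weak_limit_fixed T_nonexp Cx Cp xp xM xT.
have Ap := weak_limit_inverse_strongly_monotone alpha_gt0 A_ism Cx Cp xp xM Aw.
split; first by split; [exact: Cp|exact: Tp].
by split; [exact: Cp|move=> y Cy; rewrite Ap wp].
Qed.

Lemma common_solutions_convex : convex_set S.
Proof.
apply/convex_setP => p q t [Fp Vp] [Fq Vq] t0 t1.
have /convex_setP Fcv := fixed_points_convex C_convex T_nonexp.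
have /convex_setP Vcv := VI_solutions_convex C_convex alpha_gt0 A_ism.
by split; [exact: Fcv|exact: Vcv].
Qed.

(** Apply the previous criterion to the identity along the trace of the neighbourhoods of p on [S],
    where [A] is constantly A p0. *)
Lemma common_solutions_closed : closed S.
Proof.
move=> p clp; have FF : ProperFilter (within S (nbhs p)).
  exact: within_nbhs_proper.
have [p0 [S0 _]] := clp _ filterT.
have Snear : \forall x \near within S (nbhs p), S x by exact: withinT.
have idp : id @ within S (nbhs p) --> p by exact: cvg_within.
apply: (@weak_limit_common_solution _ _ id p (A p0) (`|p| + 1) FF).
- by apply: filterS Snear => x [[]].
- exact: cvg_weak_limit.
- by apply: cvgr_norm_le idp _ _; rewrite ltrDl.
- apply: cvg_near_cst; apply: filterS Snear => x [[_ Tx] _].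
  by rewrite Tx subrr.
- apply: cvg_near_cst; apply: filterS Snear => x [_ Vx].
  exact: (VI_solutions_eq alpha_gt0 A_ism Vx S0.2).
- move=> y Cy.
  apply: (@cvgr_to_ge _ (within S (nbhs p)) _ _ (fun x => dot (A p0) (y - x))).
    under eq_fun do rewrite dotDr dotNr; rewrite dotDr dotNr.
    by apply: cvgB; [exact: cvg_cst|exact: cvg_weak_limit].
  apply: filterS Snear => x [_ Vx].
  rewrite -(VI_solutions_eq alpha_gt0 A_ism Vx S0.2); exact: Vx.2.
Qed.

(** * The extragradient step *)

Let P (l : R) (v : H) := metric_proj C (v - l *: A v).

(** The bound l_i <= b yields x_i - z_i -> 0 and then x_i - T x_i -> 0; the bound l_i >= a lets the
    obtuse angle condition at z_i pass to the variational inequality at p. *)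
Lemma weak_limit_extragradient (I : Type) (F : set_system I) (x : I -> H)
    (l : I -> R) (a b : R) (p p0 : H) (M : R) : ProperFilter F ->
  0 < a -> (forall i, a <= l i <= b) -> (forall i, C (x i)) ->
  (forall i, `|x i| <= M) -> weak_limit F x p -> S p0 ->
  A (x i) - A p0 @[i --> F] --> 0 ->
  x i - P (l i) (x i) - l i *: (A (x i) - A p0) @[i --> F] --> 0 ->
  x i - T (P (l i) (x i)) @[i --> F] --> 0 -> S p.
Proof.
move=> FF a0 lab Cx xM xp [[Cp0 Tp0] Vp0] dA dz dT.
have CP r v : C (P r v) by apply: metric_proj_in => //; exists p0.
pose z i := P (l i) (x i); rewrite -/(z _) in dz dT.
have xMF : \forall i \near F, `|x i| <= M by exact: nearW.
have AxF : A (x i) @[i --> F] --> A p0 by exact/subr_cvg0.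
have norm0 (u v : I -> H) (r : R) : (forall i, `|u i| <= r * `|v i|) ->
    v @ F --> 0 -> u @ F --> 0.
  move=> uv v0; apply: norm_cvg0.
  apply: (@squeeze_cvgr _ _ _ _ (fun=> 0) (fun i => r * `|v i|)).
  - by apply: nearW => i; rewrite normr_ge0 uv.
  - exact: cvg_cst.
  - by rewrite -(mulr0 r) -(@normr0 _ H); apply: cvgMl_tmp; exact: cvg_norm.
have lA : l i *: (A (x i) - A p0) @[i --> F] --> 0.
  apply: (norm0 _ _ b) dA => i; have /andP[al lb] := lab i.
  by rewrite normrZ ler_wpM2r // ger0_norm // (le_trans (ltW a0)).
have xz : x i - z i @[i --> F] --> 0.
  suff : x i - z i - l i *: (A (x i) - A p0) + l i *: (A (x i) - A p0)
      @[i --> F] --> 0 + 0.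
    by rewrite addr0; under eq_fun do rewrite subrK.
  exact: cvgD dz lA.
have xT : x i - T (x i) @[i --> F] --> 0.
  have Tzx : T (z i) - T (x i) @[i --> F] --> 0.
    apply: (norm0 _ _ 1) xz => i; rewrite mul1r distrC.
    by apply: T_nonexp; [exact: Cx|exact: CP].
  suff : x i - T (z i) + (T (z i) - T (x i)) @[i --> F] --> 0 + 0.
    by rewrite addr0; under eq_fun do rewrite addrA subrK.
  exact: cvgD dT Tzx.
apply: (weak_limit_common_solution FF _ xp xMF xT AxF); first exact: nearW.
move=> y Cy; rewrite dotDr dotNr.
(* The vanishing terms are kept as inner products with 0, to match the approximants term by term. *)
have -> : dot (A p0) y - dot (A p0) p =
    dot y (A p0) - dot p (A p0) + dot 0 (A p0)
      + a^-1 * `|dot y 0 - dot p 0 + dot 0 0|.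
  by rewrite !dot0r !dot0l !subr0 !addr0 normr0 mulr0 addr0 !(dotC _ (A p0)).
(* Both summands are <., y - z i>, applied to A (x i) and to x i - z i. *)
apply: (@cvgr_to_ge _ F _ _ (fun i =>
    dot y (A (x i)) - dot (x i) (A (x i)) + dot (x i - z i) (A (x i))
      + a^-1 * `|dot y (x i - z i) - dot (x i) (x i - z i)
                 + dot (x i - z i) (x i - z i)|)).
  have lim w v : w @ F --> v ->
      dot y (w i) - dot (x i) (w i) + dot (x i - z i) (w i) @[i --> F]
        --> dot y v - dot p v + dot 0 v.
    move=> wv; apply: cvgD; last exact: cvg_dot.
    apply: cvgB; first by apply: cvg_dot => //; exact: cvg_cst.
    exact: (cvg_dot_weak_strong xp xMF wv).
  by apply: cvgD; [exact: lim|apply: cvgMl_tmp; apply: cvg_norm; exact: lim].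
apply: nearW => i; have /andP[al _] := lab i.
have := metric_proj_obtuse (x i - l i *: A (x i)) C_closed C_convex Cy.
rewrite -/(P _ _) -/(z i) -!dotNl -!dotDl !addrA.
have -> : y - x i + x i - z i = y - z i by rewrite subrK.
rewrite addrAC dotDl dotNl dotZl (dotC (x i - z i)) (dotC (A (x i))).
set g := dot (y - z i) (A (x i)); set s := dot (y - z i) (x i - z i) => h.
rewrite -(ler_pM2l a0) mulr0 mulrDr mulrA divff ?gt_eqF // mul1r.
have := ler_norm (- s); rewrite normrN => s_le.
(* The obtuse angle condition reads s <= l_i g; when g < 0, a g >= l_i g >= s >= -|s|. *)
by case: (lerP 0 g) => g0; [rewrite addr_ge0 // mulr_ge0 // ltW|nra].
Qed.

(** All gains come from the first half-step: averaging weights them by 1 - t >= 1 - d and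
    contributes t (1 - t) >= c (1 - d), while l (2 alpha - l) >= a (2 alpha - b). The second
    half-step only has to bring the point no farther from p than y is. *)
Lemma extragradient_sqdist (x p : H) (l t a b c d : R) :
  let y := t *: x + (1 - t) *: T (P l x) in
  (forall v, C v -> C (T v)) -> 0 <= a -> a <= l -> l <= b -> b <= 2 * alpha ->
  0 <= c -> c <= t -> t <= d -> d <= 1 -> C x -> S p ->
  (1 - d) * (a * (2 * alpha - b)) * `|A x - A p| ^+ 2
    + (1 - d) * `|x - P l x - l *: (A x - A p)| ^+ 2
    + c * (1 - d) * `|x - T (P l x)| ^+ 2
    <= `|x - p| ^+ 2 - `|T (P l y) - p| ^+ 2.
Proof.
move=> y CT a0 al lb b2 c0 ct td d1 Cx [[Cp Tp] Vp].
have C0 : C !=set0 by exists p.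
have CTP v : C (T (P l v)) by apply: CT; exact: metric_proj_in.
have Cy : C y by move/convex_setP: C_convex; apply => //; lra.
have q0 : 0 <= a * (2 * alpha - b) by rewrite mulr_ge0 // subr_ge0.
have TP_le v : C v -> `|T (P l v) - p| ^+ 2 <= `|v - p| ^+ 2
    - (a * (2 * alpha - b) * `|A v - A p| ^+ 2
       + `|v - P l v - l *: (A v - A p)| ^+ 2).
  move=> Cv; have CPv : C (P l v) by exact: metric_proj_in.
  have := forward_backward_sqdist C_closed C_convex A_ism Cv Vp
    (le_trans a0 al); rewrite -/(P _ v) /=.
  have : `|T (P l v) - p| ^+ 2 <= `|P l v - p| ^+ 2.
    by rewrite -{1}Tp ler_sqr ?nnegrE //; exact: T_nonexp.
  have : a * (2 * alpha - b) * `|A v - A p| ^+ 2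
      <= l * (2 * alpha - l) * `|A v - A p| ^+ 2.
    by rewrite ler_wpM2r ?sqr_ge0 // ler_pM // ?subr_ge0 // lerB.
  lra.
have h1 : `|T (P l y) - p| ^+ 2 <= `|y - p| ^+ 2.
  rewrite (le_trans (TP_le _ Cy)) // gerBl.
  by rewrite addr_ge0 ?sqr_ge0 // mulr_ge0 ?sqr_ge0.
have h2 : `|y - p| ^+ 2 = t * `|x - p| ^+ 2
    + (1 - t) * `|T (P l x) - p| ^+ 2 - t * (1 - t) * `|x - T (P l x)| ^+ 2.
  have -> : x - T (P l x) = (x - p) - (T (P l x) - p).
    by rewrite opprB addrA subrK.
  rewrite -sqnorm_conv /y !scalerBr addrACA -opprD -scalerDl.
  by rewrite (addrC t) subrK scale1r.
have t1 : 0 <= 1 - t by lra.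
pose B := a * (2 * alpha - b) * `|A x - A p| ^+ 2
  + `|x - P l x - l *: (A x - A p)| ^+ 2.
have h0 := ler_wpM2l t1 (TP_le _ Cx : _ <= _ - B).
set E := `|x - T _| ^+ 2 in h2 *.
have B0 : 0 <= B by rewrite addr_ge0 ?sqr_ge0 // mulr_ge0 ?sqr_ge0.
have E0 : 0 <= E := sqr_ge0 _.
have h3 : (1 - d) * B <= (1 - t) * B by rewrite ler_wpM2r //; lra.
have h4 : c * (1 - d) * E <= t * (1 - t) * E.
  by rewrite ler_wpM2r // ler_pM //; lra.
by rewrite -[_ * _ * `|A x - A p| ^+ 2]mulrA -mulrDr -/B; lra.
Qed.

End CommonSolutions.

End Hilbert.

(** * Convergence of the iteration *)

Theorem theorem1 (R : realType) (H : completeNormedModType R)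
  (dot : {dot H for (idfun : R -> R)}) (dot_norm : induces_norm dot)
  (C : set H) (C_neq0 : C !=set0) (C_closed : closed C) (C_convex : convex_set C)
  (alpha : R) (alpha_gt0 : 0 < alpha)
  (A : H -> H) (A_ism : inverse_strongly_monotone dot C alpha A)
  (T : {fun C >-> C}) (T_nonexp : nonexpansive C T)
  (F_neq0 : fixed_points C T `&` VI_solutions dot C A !=set0)
  (lambda_ : nat -> R) (a b : R)
  (a_itv : 0 < a < 2 * alpha) (b_itv : 0 < b < 2 * alpha)
  (lambda_itv : forall n, a <= lambda_ n <= b)
  (alpha_ : nat -> R) (c d : R)
  (c_itv : 0 < c < 1) (d_itv : 0 < d < 1)
  (alpha_itv : forall n, c <= alpha_ n <= d)
  (x_ y_ : nat -> H) (x0_in : C (x_ 0%N))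
  (y_def : forall n, y_ n = alpha_ n *: x_ n
     + (1 - alpha_ n) *: T (metric_proj C (x_ n - lambda_ n *: A (x_ n))))
  (x_def : forall n,
     x_ n.+1 = T (metric_proj C (y_ n - lambda_ n *: A (y_ n)))) :
  exists p : H,
    [/\ (fixed_points C T `&` VI_solutions dot C A) p,
        weakly_converges x_ p &
        metric_proj (fixed_points C T `&` VI_solutions dot C A) (x_ n)
          @[n --> \oo] --> p].
Proof.
set S := fixed_points C T `&` VI_solutions dot C A.
have Scl : closed S.
  exact: (common_solutions_closed dot_norm C_closed C_convex alpha_gt0 A_ism
    T_nonexp).
have Scv : convex_set S.
  exact: (common_solutions_convex dot_norm C_convex alpha_gt0 A_ism T_nonexp).
pose P l v := metric_proj C (v - l *: A v).
have CT v : C v -> C (T v) by exact: funS.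
have Cx n : C (x_ n).
  by case: n => [//|n]; rewrite x_def; apply: CT; exact: metric_proj_in.
have [[a0 _] [b0 b1]] := (andP a_itv, andP b_itv).
have [[c0 _] [d0 d1]] := (andP c_itv, andP d_itv).
pose B p n := (1 - d) * (a * (2 * alpha - b)) * `|A (x_ n) - A p| ^+ 2.
pose D p n := (1 - d) *
  `|x_ n - P (lambda_ n) (x_ n) - lambda_ n *: (A (x_ n) - A p)| ^+ 2.
pose E n := c * (1 - d) * `|x_ n - T (P (lambda_ n) (x_ n))| ^+ 2.
have step p n : S p ->
    B p n + D p n + E n <= `|x_ n - p| ^+ 2 - `|x_ n.+1 - p| ^+ 2.
  move=> Sp; have /andP[al lb] := lambda_itv n.
  have /andP[cn dn] := alpha_itv n.
  have := extragradient_sqdist dot_norm C_closed C_convex A_ism T_nonexp CT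
    (ltW a0) al lb (ltW b1) (ltW c0) cn dn (ltW d1) (Cx n) Sp.
  by rewrite -y_def -x_def.
have k0 : 0 < (1 - d) * (a * (2 * alpha - b)).
  by rewrite !mulr_gt0 // subr_gt0.
have d1' : 0 < 1 - d by rewrite subr_gt0.
have B0 p n : 0 <= B p n by rewrite mulr_ge0 ?sqr_ge0 // ltW.
have D0 p n : 0 <= D p n by rewrite mulr_ge0 ?sqr_ge0 // ltW.
have E0 n : 0 <= E n by rewrite mulr_ge0 ?sqr_ge0 // ltW // mulr_gt0.
have S_le p n : S p -> `|x_ n.+1 - p| <= `|x_ n - p|.
  move=> Sp; rewrite -ler_sqr ?nnegrE // -subr_ge0.
  by rewrite (le_trans _ (step p n Sp)) // !addr_ge0.
apply: (fejer_weak_cvg dot_norm F_neq0 Scl Scv S_le) => U p UU oU xp.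
(* It remains to place a weak ultralimit in [S]. For any fixed p0 in [S], the nonincreasing |x_n -
   p0|^2 converges, so its decrements, which dominate all three gains, vanish along [U]. *)
have [p0 Sp0] := F_neq0.
pose X n := `|x_ n - p0| ^+ 2.
have XU0 : X n - X n.+1 @[n --> U] --> 0.
  suff X0 : X n - X n.+1 @[n --> \oo] --> 0 by move=> V /X0; exact: oU.
  have X_cvg : cvgn X.
    apply: nonincreasing_is_cvgn; last first.
      by exists 0 => _ [n _ <-]; exact: sqr_ge0.
    by apply/nonincreasing_seqP => n; rewrite ler_sqr ?nnegrE // S_le.
  by rewrite -(subrr (limn X)); apply: cvgB => //; rewrite cvg_shiftS.
apply: (weak_limit_extragradient dot_norm C_closed C_convex alpha_gt0 A_ism
  T_nonexp _ a0 lambda_itv Cx _ xp Sp0).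
- by move=> n; exact: (fejer_bounded S_le n Sp0).
- apply: (sqnorm_squeeze0 k0 _ XU0) => n; apply: le_trans (step p0 n Sp0).
  by rewrite -addrA lerDl addr_ge0.
- apply: (sqnorm_squeeze0 d1' _ XU0) => n; apply: le_trans (step p0 n Sp0).
  by rewrite [leRHS]addrAC lerDr addr_ge0.
- apply: (sqnorm_squeeze0 (mulr_gt0 c0 d1') _ XU0) => n.
  by apply: le_trans (step p0 n Sp0); rewrite lerDr addr_ge0.
Qed.
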